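(* There exists a (randomized) streaming algorithm that, given $n$ arms arriving one by one in a stream in arbitrary order, an approximation parameter $\varepsilon\in(0,1)$, and a confidence parameter $\delta\in(0,1)$, with probability at least $1-\delta$ finds an $\varepsilon$-best arm using a memory of two arms and $O\!\left(\frac{n}{\varepsilon^2}\cdot\log(1/\delta)+\log^{2}(n)\cdot\frac{\log^{2}(1/\delta)}{\varepsilon^{3}}\right)$ arm pulls.
   Context: Stochastic multi-armed bandits. There are $n$ arms; each pull of $\mathrm{arm}_i$ yields an independent reward in $[0,1]$ drawn from an unknown distribution with mean $\mu_i\in[0,1]$. An arm $\mathrm{arm}_i$ is an $\varepsilon$-best arm if $\mu_i\ge\max_j\mu_j-\varepsilon$. No assumption is made on the gap between the largest and second largest means. The values $n,\varepsilon,\delta$ are known to the algorithm. Streaming model. The arms arrive one by one in a stream. At any time the algorithm may pull only the currently arriving arm or an arm explicitly stored in its memory; an arm that is not stored, or that is removed from memory, can no longer be pulled or recovered. The memory is the maximum number of arms stored at any point (the currently arriving arm is not counted unless stored; auxiliary information such as counters and recorded empirical rewards is not counted). At the end of the stream the algorithm outputs one arm. $O(\cdot)$ hides absolute constants. *)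

(* Defs.v *)
From mathcomp Require Import all_boot all_order all_algebra.
From mathcomp Require Import all_classical all_reals all_analysis.
From mathcomp Require Import measurable_realfun.
Import Order.TTheory GRing.Theory Num.Theory.
Import numFieldNormedType.Exports.

Set Implicit Arguments.
Unset Strict Implicit.
Unset Printing Implicit Defensive.

Local Open Scope ring_scope.

(* A randomized adaptive algorithm on a stream of n arms, written as the tree
   of its possible behaviours.  Arms are named by their position in the stream.
   A continuation sees everything that happened before it, so the auxiliary
   information (counters, recorded rewards) kept by the algorithm is unlimited;
   only the set of stored arms is tracked, by [streaming] below.
   [Toss p k] is internal randomness: continue with [k true] with probability
   p, with [k false] with probability 1 - p.  [Next] moves on to the next arm
   of the stream. *)
Inductive algorithm (R : realType) (n : nat) : Type :=
  | Output of 'I_n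
  | Pull of 'I_n & (R -> algorithm R n)
  | Toss of {i01 R} & (bool -> algorithm R n)
  | Store of 'I_n & algorithm R n
  | Discard of 'I_n & algorithm R n
  | Next of algorithm R n.
Arguments Output {R n}.
Arguments Pull {R n}.
Arguments Toss {R n}.
Arguments Store {R n}.
Arguments Discard {R n}.
Arguments Next {R n}.

(* [streaming m c M t]: on every execution, t respects the streaming model with
   memory m, when started with arm c currently arriving (c = n once the stream
   is exhausted) and with M the set of stored arms. *)
Fixpoint streaming (R : realType) (n m c : nat) (M : {set 'I_n})
    (t : algorithm R n) : Prop :=
  match t with
  | Output a => c = n /\ a \in M
  | Pull a k => (val a == c) || (a \in M) /\ forall r, streaming m c M (k r)
  | Toss _ k => forall b, streaming m c M (k b)
  | Store a t' =>
      [/\ val a = c, (#|a |: M| <= m)%N & streaming m c (a |: M) t']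
  | Discard a t' => streaming m c (M :\ a) t'
  | Next t' => (c < n)%N /\ streaming m c.+1 M t'
  end.

(* Every execution of t makes at most B arm pulls. *)
Fixpoint pulls_at_most (R : realType) (n B : nat) (t : algorithm R n) : Prop :=
  match t with
  | Output _ => True
  | Pull _ k => if B is B'.+1 then forall r, pulls_at_most B' (k r) else False
  | Toss _ k => forall b, pulls_at_most B (k b)
  | Store _ t' => pulls_at_most B t'
  | Discard _ t' => pulls_at_most B t'
  | Next t' => pulls_at_most B t'
  end.

(* The probability that t outputs an arm in A when the rewards of arm i have
   law nu i.  Each pull integrates over a fresh draw, which is the independence
   of the rewards. *)
Fixpoint output_prob (R : realType) (n : nat)
    (nu : 'I_n -> probability (measurableTypeR R) R) (A : {set 'I_n})
    (t : algorithm R n) : \bar R :=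
  match t with
  | Output a => ((a \in A)%:R)%:E
  | Pull a k => (\int[nu a]_r output_prob nu A (k r))%E
  | Toss p k => (p%:num%:E * output_prob nu A (k true)
                 + (1 - p%:num)%:E * output_prob nu A (k false))%E
  | Store _ t' => output_prob nu A t'
  | Discard _ t' => output_prob nu A t'
  | Next t' => output_prob nu A t'
  end.

(* All integrands occurring in [output_prob] are measurable; without this the
   integrals there would not be probabilities. *)
Fixpoint measurable_behaviour (R : realType) (n : nat)
    (nu : 'I_n -> probability (measurableTypeR R) R)
    (t : algorithm R n) : Prop :=
  match t with
  | Output _ => True
  | Pull _ k =>
      (forall A : {set 'I_n},
         measurable_fun [set: measurableTypeR R]
           (fun r : measurableTypeR R => output_prob nu A (k r)))
      /\ forall r, measurable_behaviour nu (k r)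
  | Toss _ k => forall b, measurable_behaviour nu (k b)
  | Store _ t' => measurable_behaviour nu t'
  | Discard _ t' => measurable_behaviour nu t'
  | Next t' => measurable_behaviour nu t'
  end.

Definition mean (R : realType) (mu : probability (measurableTypeR R) R) : R :=
  fine (\int[mu]_r r%:E)%E.

(* The maximum is seeded with one of its own terms, so no artificial value
   enters it. *)
Definition best_arms (R : realType) (n : nat)
    (nu : 'I_n -> probability (measurableTypeR R) R) (eps : R) : {set 'I_n} :=
  [set i | mean (nu i) >=
           (\big[Num.max/mean (nu i)]_(j < n) mean (nu j)) - eps]%SET.

(* Main.v *)
(* The memory holds a king, the stored arm, which every arriving arm challenges.
   A challenge is a sequence of rounds; round i draws 8^i s0 fresh rewards from
   both arms, s0 ~ log(1/delta)/eps^2, and rejects the challenger unless its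
   empirical mean exceeds that of the king by (eps/4)(1 + 2^-i).  Passing all
   rounds makes the challenger the new king.

   Correctness.  The number of rounds grows with the number j of challengers the
   king has rejected so that a false accept has probability at most x^(j+1), with
   x ~ delta; hence a reign contributes O(x).  A correct accept raises the mean
   of the king by eps/8, so at most 8 reigns follow once the best arm has been
   met, and the drift of the king's mean stays below eps.

   Cost.  The last round of an accepted challenge costs O(j s0), which is paid
   for by the j arms rejected before.  Since the thresholds decrease with i, an
   arm is rejected in a late round only after a deviation in that round or the
   previous one, so the expected cost of late rejections is O(x^2 s0) per arm; by
   Markov's inequality a budget of O(n s0) for them suffices.  Altogether
   O(n log(1/delta)/eps^2) pulls are made.

   If delta > 1/2, this is run with confidence 1/2 on one of about
   1/(2(1 - delta)) consecutive blocks of arms, chosen uniformly. *)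

Require Import Defs.
From mathcomp Require Import all_boot all_order all_algebra.
From mathcomp Require Import all_classical all_reals all_analysis.
From mathcomp Require Import measurable_realfun ring lra zify.
Import Order.TTheory GRing.Theory Num.Theory.
Import numFieldNormedType.Exports.
Local Open Scope ring_scope.

Set Implicit Arguments.
Unset Strict Implicit.
Unset Printing Implicit Defensive.

(** * Programs with Bernoulli rewards *)

(** A toss needs a bias in [0, 1] for every real reward; for laws carried by [0, 1], clamping
    changes rewards on a null set only. *)
Definition clamp01 {R : realType} (r : R) : R := Num.max 0 (Num.min r 1).

Lemma clamp01_ge0 (R : realType) (r : R) : 0 <= clamp01 r.
Proof. by rewrite /clamp01 le_max lexx. Qed.

Lemma clamp01_le1 (R : realType) (r : R) : clamp01 r <= 1.
Proof. by rewrite /clamp01 ge_max ler01 ge_min lexx orbT. Qed.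

Lemma clamp01_id (R : realType) (r : R) : 0 <= r <= 1 -> clamp01 r = r.
Proof. by move=> /andP[r0 r1]; rewrite /clamp01 (min_idPl r1) (max_idPr r0). Qed.

Definition clamp_i01 {R : realType} (r : R) : {i01 R} :=
  Itv01 (clamp01_ge0 r) (clamp01_le1 r).

(** Branching on bits only makes the value of a program a polynomial in the means, so measurability
    and integration are settled once, for [compile]. *)
Inductive program (R : realType) (n : nat) : Type :=
  | POutput of 'I_n
  | PFlip of 'I_n & (bool -> program R n)
  | PToss of {i01 R} & (bool -> program R n)
  | PStore of 'I_n & program R n
  | PDiscard of 'I_n & program R n
  | PNext of program R n.
Arguments POutput {R n}.
Arguments PFlip {R n}.
Arguments PToss {R n}.
Arguments PStore {R n}.
Arguments PDiscard {R n}.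
Arguments PNext {R n}.

(* Tossing a coin whose bias is the reward just seen turns any law on [0, 1]
   into the Bernoulli law with the same mean, so only means matter below. *)
Fixpoint compile (R : realType) (n : nat) (t : program R n) : algorithm R n :=
  match t with
  | POutput a => Output a
  | PFlip a k => Pull a (fun r => Toss (clamp_i01 r) (fun b => compile (k b)))
  | PToss p k => Toss p (fun b => compile (k b))
  | PStore a t' => Store a (compile t')
  | PDiscard a t' => Discard a (compile t')
  | PNext t' => Next (compile t')
  end.

Fixpoint value (R : realType) (n : nat) (mu f : 'I_n -> R) (t : program R n)
    : R :=
  match t with
  | POutput a => f a
  | PFlip a k => mu a * value mu f (k true) + (1 - mu a) * value mu f (k false)
  | PToss p k =>
      p%:num * value mu f (k true) + (1 - p%:num) * value mu f (k false)
  | PStore _ t' => value mu f t'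
  | PDiscard _ t' => value mu f t'
  | PNext t' => value mu f t'
  end.

(** * Integrals against a reward law *)

Section reward_law.
Context {R : realType} (nu : probability (measurableTypeR R) R).
Hypothesis nu01 : nu `[0, 1]%classic = 1%E.

Lemma measurable_clamp01 :
  measurable_fun setT (@clamp01 R : measurableTypeR R -> measurableTypeR R).
Proof.
apply: measurable_maxr; first exact: measurable_cst.
apply: measurable_minr; [exact: measurable_id|exact: measurable_cst].
Qed.

Lemma integrable_clamp01 :
  nu.-integrable [set: measurableTypeR R] (EFin \o @clamp01 R).
Proof.
apply: measurable_bounded_integrable => //.
- by rewrite ltey_eq fin_num_measure.
- exact: measurable_clamp01.
- exists 1; split; first by rewrite num_real.
  move=> x x1 y _ /=.
  by rewrite ger0_norm ?clamp01_ge0 ?(le_trans (clamp01_le1 y)) ?ltW.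
Qed.

Lemma mean_clamp01 : (\int[nu]_r (clamp01 r)%:E)%E = (mean nu)%:E.
Proof.
have E : (\int[nu]_r (clamp01 r)%:E = \int[nu]_r r%:E)%E.
  apply: ae_eq_integral => //.
  - by apply/measurable_EFinP; exact: measurable_clamp01.
  - exists (~` `[0, 1]%classic)%classic; split.
    + by apply: measurableC; exact: measurable_itv.
    + rewrite [LHS]probability_setC ?nu01 ?subee//; exact: measurable_itv.
    + move=> x /= H x01; apply: H => _; congr EFin.
      by apply: clamp01_id; move: x01; rewrite /= in_itv.
rewrite /mean -E fineK//.
apply: integrable_fin_num => //; exact: integrable_clamp01.
Qed.

Lemma mean_itv : 0 <= mean nu <= 1.
Proof.
rewrite -!lee_fin -mean_clamp01; apply/andP; split.
  by apply: integral_ge0 => x _; rewrite lee_fin clamp01_ge0.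
have -> : (1 = \int[nu]_r (cst 1%:E r))%E.
  by rewrite integral_cst//= probability_setT mul1e.
apply: ge0_le_integral => //.
- by move=> x _; rewrite lee_fin clamp01_ge0.
- by apply/measurable_EFinP; exact: measurable_clamp01.
- by move=> x _; rewrite lee_fin clamp01_le1.
Qed.

Lemma measurable_flip (u v : R) :
  measurable_fun [set: measurableTypeR R]
    (fun r => (clamp01 r * u + (1 - clamp01 r) * v)%:E).
Proof.
apply/measurable_EFinP; apply: measurable_funD; apply: measurable_funM => //.
- exact: measurable_clamp01.
- by apply: measurable_funB => //; exact: measurable_clamp01.
Qed.

Lemma integral_flip (u v : R) :
  (\int[nu]_r (clamp01 r * u + (1 - clamp01 r) * v)%:E)%E
  = (mean nu * u + (1 - mean nu) * v)%:E.
Proof.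
under eq_integral => r _.
  rewrite (_ : _ * u + _ = (u - v) * clamp01 r + v); last by ring.
  rewrite EFinD EFinM; over.
rewrite integralD//=.
- rewrite integralZl//; last exact: integrable_clamp01.
  rewrite mean_clamp01 integral_cst//= probability_setT mule1 -EFinM -EFinD.
  by congr EFin; ring.
- by apply: integrableZl => //; exact: integrable_clamp01.
- exact: finite_measure_integrable_cst.
Qed.

End reward_law.

Lemma output_prob_compile (R : realType) (n : nat)
    (nu : 'I_n -> probability (measurableTypeR R) R)
    (nu01 : forall i, nu i `[0, 1]%classic = 1%E) (A : {set 'I_n})
    (t : program R n) :
  output_prob nu A (compile t)
  = (value (fun i => mean (nu i)) (fun a => (a \in A)%:R) t)%:E.
Proof.
elim: t => //= a k IH.
  by under eq_integral => r _ do rewrite !IH -!EFinM -EFinD; exact: integral_flip.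
by rewrite !IH -!EFinM -EFinD.
Qed.

Lemma measurable_compile (R : realType) (n : nat)
    (nu : 'I_n -> probability (measurableTypeR R) R)
    (nu01 : forall i, nu i `[0, 1]%classic = 1%E) (t : program R n) :
  measurable_behaviour nu (compile t).
Proof.
elim: t => //= a k IH; split=> // A.
apply: eq_measurable_fun (measurable_flip _ _) => r _ /=.
by rewrite !output_prob_compile// -!EFinM -EFinD.
Qed.

(** * Concentration of a duel *)

Definition bern {R : realType} (p : R) (g : bool -> R) : R :=
  p * g true + (1 - p) * g false.

Fixpoint duel_expect (R : realType) (p q : R) (s : nat) (f : R -> R) (z : R)
    : R :=
  if s is s'.+1 then
    bern p (fun b => bern q (fun b' =>
      duel_expect p q s' f (z + b'%:R - b%:R)))
  else f z.

Section duel_expect.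
Context {R : realType} (p q : R).
Hypotheses (p01 : 0 <= p <= 1) (q01 : 0 <= q <= 1).

Lemma bern_le (r : R) (g h : bool -> R) : 0 <= r <= 1 ->
  (forall b, g b <= h b) -> bern r g <= bern r h.
Proof.
move=> /andP[r0 r1] gh; rewrite /bern lerD// ler_wpM2l ?subr_ge0//.
Qed.

Lemma duel_expect_le (s : nat) (f g : R -> R) (z : R) :
  (forall y, f y <= g y) -> duel_expect p q s f z <= duel_expect p q s g z.
Proof.
move=> fg; elim: s z => //= s IH z.
by apply: bern_le => // b; apply: bern_le => // b'; exact: IH.
Qed.

Lemma duel_expect_cst (s : nat) (c z : R) :
  duel_expect p q s (fun=> c) z = c.
Proof. by elim: s z => //= s IH z; rewrite /bern !IH; ring. Qed.

Lemma duel_expect_lin (s : nat) (f : R -> R) (c d z : R) :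
  duel_expect p q s (fun y => c * f y + d) z = c * duel_expect p q s f z + d.
Proof. by elim: s z => //= s IH z; rewrite /bern !IH; ring. Qed.

Lemma eq_duel_expect (s : nat) (f g : R -> R) (z : R) : f =1 g ->
  duel_expect p q s f z = duel_expect p q s g z.
Proof. by move=> fg; elim: s z => //= s IH z; rewrite /bern !IH. Qed.

Lemma duel_expect_expR (s : nat) (l z : R) :
  duel_expect p q s (fun y => expR (l * y)) z
  = expR (l * z)
    * (bern p (fun b => expR (- l * b%:R)) * bern q (fun b => expR (l * b%:R)))
      ^+ s.
Proof.
elim: s z => [|s IH] z /=; first by rewrite expr0 mulr1.
have e (b b' : bool) : expR (l * (z + b'%:R - b%:R))
    = expR (l * z) * (expR (- l * b%:R) * expR (l * b'%:R)).
  by rewrite -!expRD; congr expR; ring.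
by rewrite exprS /bern !IH !e; ring.
Qed.

Definition win_prob (s : nat) (t : R) : R :=
  duel_expect p q s (fun z => (t <= z)%R%:R) 0.

Lemma win_prob_itv (s : nat) (t : R) : 0 <= win_prob s t <= 1.
Proof.
apply/andP; split.
  rewrite -(duel_expect_cst s 0 0); apply: duel_expect_le => y; exact: ler0n.
by rewrite -(duel_expect_cst s 1 0); apply: duel_expect_le => y; case: (t <= y).
Qed.

Lemma duel_expect_if (s : nat) (t u v : R) :
  duel_expect p q s (fun z => if t <= z then u else v) 0
  = win_prob s t * u + (1 - win_prob s t) * v.
Proof.
rewrite (@eq_duel_expect _ _ (fun z => (u - v) * (t <= z)%R%:R + v)).
  by rewrite duel_expect_lin /win_prob; ring.
by move=> z; case: (t <= z) => /=; ring.
Qed.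

Lemma expR_ge1 (y : R) : 0 <= y -> 1 <= expR y.
Proof. by move=> y0; rewrite (le_trans _ (expR_ge1Dx y))// lerDl. Qed.

(** From 1 - y <= exp(-y) follows (1 - y) exp(y) <= 1, while (1 - y)(1 + y + 2 y^2) >= 1 for y <=
    1/2. *)
Lemma expR_le_quadratic (y : R) : y <= 1 / 2 -> expR y <= 1 + y + 2 * y ^+ 2.
Proof.
move=> y2.
have e0 := expR_gt0 y; have := expR_ge1Dx (- y); rewrite expRN => H.
have {H} : (1 - y) * expR y <= 1.
  by rewrite -(ler_pdivlMr _ _ e0) div1r.
have : 0 <= y ^+ 2 * (1 - 2 * y) by rewrite mulr_ge0 ?sqr_ge0//; lra.
nra.
Qed.

Lemma bern_expR_le (r l : R) : 0 <= r <= 1 -> l <= 1 / 2 ->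
  bern r (fun b => expR (l * b%:R)) <= expR (r * l + 2 * l ^+ 2).
Proof.
move=> /andP[r0 r1] l2; apply: le_trans (expR_ge1Dx _).
rewrite /bern mulr1 mulr0 expR0.
have := expR_le_quadratic l2; have := sqr_ge0 l; nra.
Qed.

Lemma bern_expR_ge0 (r l : R) : 0 <= r <= 1 ->
  0 <= bern r (fun b => expR (l * b%:R)).
Proof.
by move=> /andP[r0 r1]; rewrite addr_ge0// mulr_ge0 ?subr_ge0// ltW ?expR_gt0.
Qed.

(** As [l] may have either sign, one exponential bound serves both tails; the quadratic terms of the
    two coins add up to 4 l^2. *)
Lemma chernoff (s : nat) (l t : R) (f : R -> R) : - (1 / 2) <= l <= 1 / 2 ->
  (forall z, f z <= expR (l * z) / expR (l * t)) ->
  duel_expect p q s f 0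
  <= expR (s%:R * ((q - p) * l + 4 * l ^+ 2) - l * t).
Proof.
move=> /andP[l1 l2] fle.
apply: le_trans (duel_expect_le _ _ fle) _.
rewrite (@eq_duel_expect _ _
  (fun z => (expR (l * t))^-1 * expR (l * z) + 0)); last first.
  by move=> z; rewrite addr0 mulrC.
rewrite duel_expect_lin addr0 duel_expect_expR mulr0 expR0 mul1r.
rewrite expRD expRN mulrC ler_wpM2r ?invr_ge0 ?(ltW (expR_gt0 _))//.
rewrite expRM_natl lerXn2r ?nnegrE ?(ltW (expR_gt0 _))//.
  by rewrite mulr_ge0// bern_expR_ge0.
have -> : (q - p) * l + 4 * l ^+ 2
  = (p * - l + 2 * (- l) ^+ 2) + (q * l + 2 * l ^+ 2) by ring.
rewrite expRD ler_pM ?bern_expR_ge0//; apply: bern_expR_le => //; lra.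
Qed.

Lemma win_prob_le (s : nat) (h th : R) : 0 <= h <= 1 -> q - p + h <= th ->
  win_prob s (th * s%:R) <= expR (- (s%:R * h ^+ 2 / 16)).
Proof.
move=> /andP[h0 h1] hth.
(* The choice l = h/8 maximises h l - 4 l^2, with value h^2/16. *)
apply: le_trans (@chernoff s (h / 8) (th * s%:R) _ _ _) _.
- by apply/andP; split; lra.
- move=> z; rewrite -expRN -expRD; case: (leP (th * s%:R) z) => tz /=.
    have : 0 <= h * (z - th * s%:R) by rewrite mulr_ge0// subr_ge0.
    by move=> hz; apply: expR_ge1; lra.
  by rewrite ltW ?expR_gt0.
- rewrite ler_expR; have s0 : 0 <= s%:R :> R by [].
  have : 0 <= s%:R * (h * (th - (q - p + h))).
    by rewrite !mulr_ge0// subr_ge0.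
  by move: s0; set S := s%:R => s0; nra.
Qed.

Lemma win_prob_ge (s : nat) (h th : R) : 0 <= h <= 1 -> th + h <= q - p ->
  1 - win_prob s (th * s%:R) <= expR (- (s%:R * h ^+ 2 / 16)).
Proof.
move=> /andP[h0 h1] hth.
rewrite (_ : 1 - _ = duel_expect p q s
    (fun z => -1 * (th * s%:R <= z)%R%:R + 1) 0); last first.
  by rewrite duel_expect_lin /win_prob; ring.
apply: le_trans (@chernoff s (- (h / 8)) (th * s%:R) _ _ _) _.
- by apply/andP; split; lra.
- move=> z; rewrite -expRN -expRD; case: (leP (th * s%:R) z) => tz /=.
    by rewrite mulr1 addNr ltW ?expR_gt0.
  have : 0 <= h * (th * s%:R - z) by rewrite mulr_ge0// subr_ge0 ltW.
  by move=> hz; rewrite mulr0 add0r; apply: expR_ge1; lra.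
- rewrite ler_expR; have s0 : 0 <= s%:R :> R by [].
  have : 0 <= s%:R * (h * (q - p - (th + h))).
    by rewrite !mulr_ge0// subr_ge0.
  by move: s0; set S := s%:R => s0; nra.
Qed.

End duel_expect.

(** * The streaming algorithm *)

Section king_of_the_hill.
Context {R : realType} {n : nat}.

Fixpoint duel (a b : 'I_n.+1) (s : nat) (z : R) (k : R -> program R n.+1)
    : program R n.+1 :=
  if s is s'.+1 then
    PFlip a (fun x => PFlip b (fun y => duel a b s' (z + y%:R - x%:R) k))
  else k z.

Context (eps : R) (s0 : nat).

(** From one round to the next the gap between thresholds halves and its square loses a factor 4;
    the factor 8 thus doubles the exponent of the deviation bound. *)
Definition samples (i : nat) : nat := (8 ^ i * s0)%N.

Definition threshold (i : nat) : R := eps / 4 * (1 + 2 ^- i).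

Fixpoint challenge (king a : 'I_n.+1) (i r : nat)
    (acc : program R n.+1) (rej : nat -> program R n.+1) : program R n.+1 :=
  if r is r'.+1 then
    duel king a (samples i) 0 (fun z =>
      if threshold i * (samples i)%:R <= z
      then challenge king a i.+1 r' acc rej else rej i)
  else acc.

(** An output is legal only once the stream is exhausted, hence the skipping. *)
Definition finish (c : nat) (king : 'I_n.+1) : program R n.+1 :=
  iter (n.+1 - c) PNext (POutput king).

(* The pulls of the base round are affordable for every arm; only those of
   longer challenges that end in a rejection are charged to the budget. *)
Definition charge (i : nat) : nat := if i is 0 then 0 else (8 ^ i.+1 * s0)%N.

(** With K the last round, 8^K <= j + 1 lets earlier rejections pay for an accept, and j + 1 <
    8^(K+1) brings a false accept down to x^(j+1). *)
Definition rounds (j : nat) : nat := (trunc_log 8 j.+1).+1.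

(* [m] arms are still to be considered, [c] is the arriving one, [j] counts the
   arms rejected by the current king and [b] is the remaining budget. *)
Fixpoint scan (m c : nat) (king : 'I_n.+1) (j b : nat) : program R n.+1 :=
  if m is m'.+1 then
    let a := inord c in
    challenge king a 0 (rounds j)
      (PStore a (PDiscard king (PNext (scan m' c.+1 a 0 b))))
      (fun i => PNext (if (charge i <= b)%N
                       then scan m' c.+1 king j.+1 (b - charge i)
                       else finish c.+1 king))
  else finish c king.

Lemma scanS (m c : nat) (king : 'I_n.+1) (j b : nat) :
  scan m.+1 c king j b =
  challenge king (inord c) 0 (rounds j)
    (PStore (inord c) (PDiscard king (PNext (scan m c.+1 (inord c) 0 b))))
    (fun i => PNext (if (charge i <= b)%N
                     then scan m c.+1 king j.+1 (b - charge i)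
                     else finish c.+1 king)).
Proof. by []. Qed.

Definition scan_from (lo m b : nat) : program R n.+1 :=
  iter lo PNext (PStore (inord lo) (PNext (scan m lo.+1 (inord lo) 0 b))).

(** * Compliance with the streaming model *)

Lemma streaming_duel (m c : nat) (M : {set 'I_n.+1}) (a b : 'I_n.+1) (s : nat)
    (z : R) (k : R -> program R n.+1) :
  a \in M -> val b = c -> (forall y, streaming m c M (compile (k y))) ->
  streaming m c M (compile (duel a b s z k)).
Proof.
move=> aM bc Hk; elim: s z => [|s IH] z //=; rewrite aM orbT; split=> // _ x.
by split; [rewrite bc eqxx|move=> _ y; exact: IH].
Qed.

Lemma streaming_challenge (m c : nat) (M : {set 'I_n.+1}) (king a : 'I_n.+1)
    (i r : nat) (acc : program R n.+1) (rej : nat -> program R n.+1) :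
  king \in M -> val a = c -> streaming m c M (compile acc) ->
  (forall l, streaming m c M (compile (rej l))) ->
  streaming m c M (compile (challenge king a i r acc rej)).
Proof.
move=> kM ac Hacc Hrej; elim: r i => //= r IH i.
by apply: streaming_duel => // y; case: ifP.
Qed.

Lemma streaming_iter_next (m c k : nat) (M : {set 'I_n.+1})
    (t : program R n.+1) : (c + k <= n.+1)%N ->
  streaming m (c + k) M (compile t) ->
  streaming m c M (compile (iter k PNext t)).
Proof.
elim: k c => [|k IH] c; first by rewrite addn0.
rewrite addnS -addSn => ck H /=; split; first by lia.
exact: IH.
Qed.

Lemma streaming_finish (m c : nat) (M : {set 'I_n.+1}) (king : 'I_n.+1) :
  (c <= n.+1)%N -> king \in M -> streaming m c M (compile (finish c king)).
Proof.
by move=> cn kM; apply: streaming_iter_next => /=; rewrite subnKC.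
Qed.

(** Two slots are occupied only between storing the winner and discarding the old king. As the king
    precedes [c], it differs from the arriving arm, so the discard leaves exactly the winner. *)
Lemma streaming_scan (m c : nat) (king : 'I_n.+1) (j b : nat) :
  (king < c)%N -> (c + m <= n.+1)%N ->
  streaming 2 c (finset.set1 king) (compile (scan m c king j b)).
Proof.
elim: m c king j b => [|m IH] c king j b kc cm.
  by apply: streaming_finish; [lia|rewrite finset.inE].
have vc : val (inord c : 'I_n.+1) = c by rewrite /= inordK//; lia.
have neq : king != inord c by apply/eqP => E; move: kc; rewrite E vc ltnn.
apply: streaming_challenge => //=.
- by rewrite finset.inE.
- split=> //; first by rewrite cards2; case: (_ != _).
  rewrite finset.setUC finset.setU1K ?finset.inE//.
  by split; [lia|apply: IH; [rewrite vc|lia]].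
- move=> l; split; first by lia.
  case: ifP => _; first by apply: IH; lia.
  by apply: streaming_finish; [lia|rewrite finset.inE].
Qed.

Lemma streaming_scan_from (lo m b : nat) : (lo + m <= n)%N ->
  streaming 2 0 finset.set0 (compile (scan_from lo m b)).
Proof.
move=> lom; apply: streaming_iter_next; first by rewrite add0n; lia.
have vlo : val (inord lo : 'I_n.+1) = lo by rewrite /= inordK//; lia.
rewrite add0n /=; split=> //; first by rewrite finset.setU0 finset.cards1.
rewrite finset.setU0; split; first by lia.
by apply: streaming_scan; [rewrite vlo|lia].
Qed.

(** * Worst-case number of pulls *)

Lemma pulls_at_mostW (B B' : nat) (t : algorithm R n.+1) : (B <= B')%N ->
  pulls_at_most B t -> pulls_at_most B' t.
Proof.
elim: t B B' => [a|a k IH|p k IH|a t IH|a t IH|t IH] B B' BB' //=.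
- by case: B B' BB' => [|B] [|B'] // BB' H r; exact: (IH r B B').
- by move=> H x; exact: (IH x B B').
- exact: IH.
- exact: IH.
- exact: IH.
Qed.

Lemma pulls_duel (B : nat) (a b : 'I_n.+1) (s : nat) (z : R)
    (k : R -> program R n.+1) :
  (forall y, pulls_at_most B (compile (k y))) ->
  pulls_at_most (2 * s + B) (compile (duel a b s z k)).
Proof.
move=> Hk; elim: s z => [|s IH] z; first by rewrite muln0; exact: Hk.
by rewrite mulnS /= => _ x _ y; exact: IH.
Qed.

(** Rounds [i] to [l] use 2 s0 (8^i + ... + 8^l) <= (8^(l+1) - 8^i) s0 pulls; the subtracted term is
    moved to the other side in the hypotheses. *)
Lemma pulls_challenge (T Bacc : nat) (Brej : nat -> nat) (king a : 'I_n.+1)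
    (i r : nat) (acc : program R n.+1) (rej : nat -> program R n.+1) :
  pulls_at_most Bacc (compile acc) ->
  (forall l, (i <= l < i + r)%N -> pulls_at_most (Brej l) (compile (rej l))) ->
  (8 ^ (i + r) * s0 + Bacc <= T + 8 ^ i * s0)%N ->
  (forall l, (i <= l < i + r)%N ->
    (8 ^ l.+1 * s0 + Brej l <= T + 8 ^ i * s0)%N) ->
  pulls_at_most T (compile (challenge king a i r acc rej)).
Proof.
move=> Hacc; elim: r i T => [|r IH] i T Hrej Tacc Trej /=.
  by apply: pulls_at_mostW Hacc; move: Tacc; rewrite addn0; lia.
have Ti : (2 * samples i + Brej i <= T)%N.
  by move: (Trej i); rewrite leqnn addnS ltnS leq_addr /samples expnS; lia.
rewrite -(subnKC (leq_trans (leq_addr _ _) Ti)).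
apply: pulls_duel => y; case: ifP => _.
- apply: IH.
  + by move=> l Hl; apply: Hrej; lia.
  + by move: Ti Tacc; rewrite /samples addSn addnS (expnS 8 i); lia.
  + move=> l Hl; have := Trej l; move: Ti; rewrite /samples (expnS 8 i).
    by move=> Ti /(_ _); lia.
- by apply: pulls_at_mostW (Hrej i _); lia.
Qed.

Lemma pulls_iter_next (B k : nat) (t : program R n.+1) :
  pulls_at_most B (compile t) -> pulls_at_most B (compile (iter k PNext t)).
Proof. by elim: k. Qed.

(** Amortisation: each arm brings 16 s0, of which a rejection spends at most half on the base round
    and adds 8 s0 to the reserve 8 s0 j. An accept draws on the reserve, a late rejection on [b]. *)
Lemma pulls_scan (m c : nat) (king : 'I_n.+1) (j b : nat) :
  pulls_at_most (b + 8 * s0 * (j + 2 * m)) (compile (scan m c king j b)).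
Proof.
elim: m c king j b => [|m IH] c king j b; first exact: pulls_iter_next.
have /andP[Kj _] : (8 ^ trunc_log 8 j.+1 <= j.+1 < 8 ^ (rounds j))%N.
  exact: trunc_log_bounds.
have Kj' : (8 ^ (rounds j) * s0 <= 8 * s0 * j.+1)%N.
  by rewrite expnS; nia.
rewrite scanS; apply: (@pulls_challenge _ (b + 8 * s0 * (0 + 2 * m)) (fun l =>
  if (charge l <= b)%N then (b - charge l + 8 * s0 * (j.+1 + 2 * m))%N else 0%N)).
- exact: IH.
- by move=> l _ /=; case: ifP => _; [exact: IH|exact: pulls_iter_next].
- by rewrite add0n; lia.
- move=> l; rewrite add0n /= => lr.
  have : (8 ^ l.+1 * s0 <= 8 ^ (rounds j) * s0)%N.
    by rewrite leq_mul2r leq_exp2l ?lr ?orbT.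
  (* A challenge that overruns the budget has already been pulled; the reserve pays for it, and the
     scan stops. *)
  case: ifP => lb; last by lia.
  case: l lr lb => [|l] lr lb /=; last by move: lb; rewrite /charge; lia.
  by rewrite expn1; lia.
Qed.

Lemma pulls_scan_from (lo m b : nat) :
  pulls_at_most (b + 16 * s0 * m) (compile (scan_from lo m b)).
Proof.
apply: pulls_iter_next => /=.
by apply: pulls_at_mostW (pulls_scan _ _ _ _ _); rewrite add0n; lia.
Qed.

(** * Values of the programs *)

Context (mu f : 'I_n.+1 -> R).

Fixpoint chal (w : nat -> R) (acc : R) (rej : nat -> R) (i r : nat) : R :=
  if r is r'.+1 then
    w i * chal w acc rej i.+1 r' + (1 - w i) * rej i
  else acc.

Lemma value_duel (a b : 'I_n.+1) (s : nat) (z : R) (k : R -> program R n.+1) :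
  value mu f (duel a b s z k)
  = duel_expect (mu a) (mu b) s (fun y => value mu f (k y)) z.
Proof. by elim: s z => //= s IH z; rewrite !IH. Qed.

Lemma value_challenge (king a : 'I_n.+1) (i r : nat) (acc : program R n.+1)
    (rej : nat -> program R n.+1) :
  value mu f (challenge king a i r acc rej)
  = chal (fun l => win_prob (mu king) (mu a) (samples l)
                     (threshold l * (samples l)%:R))
      (value mu f acc) (fun l => value mu f (rej l)) i r.
Proof.
elim: r i => //= r IH i; rewrite value_duel -IH -duel_expect_if.
by apply: eq_duel_expect => z; case: ifP.
Qed.

Lemma value_iter_next (k : nat) (t : program R n.+1) :
  value mu f (iter k PNext t) = value mu f t.
Proof. by elim: k. Qed.

Lemma value_finish (c : nat) (king : 'I_n.+1) :
  value mu f (finish c king) = f king.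
Proof. exact: value_iter_next. Qed.

End king_of_the_hill.

(** * Failure probability *)

Lemma sum_halving (R : realType) (c : nat -> R) (N : nat) :
  (forall l, 0 <= c l) -> (forall l, c l.+1 <= c l / 2) ->
  \sum_(0 <= l < N) c l <= 2 * c 0%N.
Proof.
move=> c0 c2; apply: (@le_trans _ _ (\sum_(0 <= l < N) c l + 2 * c N)).
  by rewrite lerDl mulr_ge0.
elim: N => [|N IH]; first by rewrite big_geq// add0r.
by rewrite big_nat_recr//=; have := c2 N; lra.
Qed.

(** Round [l] is reached with at most the probability of passing round l - 1, so a rejection there
    has weight at most u l, and an accept at most the win probability of the last round. [V] is a
    baseline, [y] and [e] are excesses over it; in the induction [g] is the win probability of the
    round before [i]. *)
Lemma chal_le (R : realType) (w : nat -> R) (acc : R) (rej : nat -> R)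
    (V e : R) (y u : nat -> R) (g : R) (i r : nat) :
  (forall l, 0 <= w l <= 1) -> 0 <= g <= 1 -> 0 <= e -> (forall l, 0 <= y l) ->
  (forall l, 0 <= u l) -> g * (1 - w i) <= u i ->
  (forall l, w l * (1 - w l.+1) <= u l.+1) ->
  acc <= V + e -> (forall l, rej l <= V + y l) ->
  g * (chal w acc rej i r - V)
  <= \sum_(i <= l < i + r) u l * y l
    + (if r is r'.+1 then w (i + r')%N else g) * e.
Proof.
move=> w01 + e0 y0 u0 + wu accV rejV.
elim: r i g => [|r IH] i g /andP[g0 g1] gu /=.
  by rewrite addn0 big_geq// add0r ler_wpM2l// lerBlDl.
have /andP[wi0 wi1] := w01 i.
have {}IH := IH i.+1 (w i) (w01 i) (wu i).
rewrite addnS -addSn big_ltn; last by rewrite ltnS leq_addr.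
have Er : (if r is r'.+1 then w (i.+1 + r')%N else w i) = w (i + r)%N.
  by case: (r) => [|r']; rewrite ?addn0// addSn addnS.
rewrite {}Er in IH.
have -> : chal w acc rej i r.+1 - V
  = w i * (chal w acc rej i.+1 r - V) + (1 - w i) * (rej i - V).
  by rewrite /=; ring.
rewrite mulrDr mulrA [leRHS]addrAC [leRHS]addrC [leRHS]addrA.
set S := \sum_(_ <= _ < _) _ in IH *.
(* Nonnegativity of the remaining bound allows the factor [g] to be dropped, so that only the latest
   round is remembered. *)
have S0 : 0 <= S + w (i + r)%N * e.
  apply: addr_ge0; first by apply: sumr_ge0 => l _; rewrite mulr_ge0.
  by rewrite mulr_ge0//; case/andP: (w01 (i + r)%N).
have H1 : g * w i * (chal w acc rej i.+1 r - V) <= S + w (i + r)%N * e.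
  rewrite -mulrA; apply: le_trans (_ : g * (S + w (i + r)%N * e) <= _).
    exact: ler_wpM2l.
  by rewrite ler_piMl.
have H2 : g * ((1 - w i) * (rej i - V)) <= u i * y i.
  rewrite mulrA; apply: le_trans (_ : g * (1 - w i) * y i <= _).
    by rewrite ler_wpM2l ?mulr_ge0 ?subr_ge0// lerBlDl.
  exact: ler_wpM2r.
by move: H1 H2; lra.
Qed.

Section analysis.
Context {R : realType} {n : nat} (eps : R) (s0 : nat) (mu f : 'I_n.+1 -> R).
Hypothesis eps01 : 0 < eps < 1.
Hypothesis mu01 : forall i, 0 <= mu i <= 1.
Hypothesis f01 : forall i, 0 <= f i <= 1.

(** The constant 8192 = 2 * 16 * 16^2 makes the bound in [late_rejection] an exact power: 16 comes
    from the tail bound, 16^2 from the margin, 2 from the exponent 2^(l+1). *)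
Definition miss : R := expR (- (eps ^+ 2 * s0%:R / 8192)).
Local Notation x := miss.

Hypothesis x_le : x <= 1 / 4.

Local Notation wins king a l :=
  (win_prob (mu king) (mu a) (samples s0 l) (threshold eps l * (samples s0 l)%:R)).

Lemma miss_gt0 : 0 < x. Proof. exact: expR_gt0. Qed.

Lemma miss_expE (k : nat) (y : R) :
  y = k%:R * (eps ^+ 2 * s0%:R / 8192) -> expR (- y) = x ^+ k.
Proof. by move=> ->; rewrite -mulrN expRM_natl. Qed.

Lemma le_miss_exp (k l : nat) : (k <= l)%N -> x ^+ l <= x ^+ k.
Proof.
move=> kl; apply: ler_wiXn2l kl; first exact: ltW miss_gt0.
by have := x_le; lra.
Qed.

Lemma wins_itv king a l : 0 <= wins king a l <= 1.
Proof. exact: win_prob_itv. Qed.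

(* Half way between two consecutive thresholds one of the two rounds is
   unlikely to go the way that produces this late rejection. *)
Lemma late_rejection king a l :
  wins king a l * (1 - wins king a l.+1) <= x ^+ (2 ^ l.+1).
Proof.
have /andP[e0 e1] := eps01.
have /andP[a0 a1] := wins_itv king a l.
have /andP[b0 b1] := wins_itv king a l.+1.
pose d : R := 2 ^- l.
have d0 : 0 < d by rewrite invr_gt0 exprn_gt0.
have d1 : d <= 1 by rewrite invf_le1 ?exprn_gt0// exprn_ege1// ler1n.
have dS : 2 ^- l.+1 = d / 2 :> R by rewrite exprSr invfM.
(* Half the distance between the thresholds [l] and [l.+1]. *)
pose h : R := eps * d / 16.
have h01 : 0 <= h <= 1 by rewrite /h; apply/andP; split; nra.
have E : (8 ^ l)%:R * d ^+ 2 = 2 ^+ l :> R.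
  have -> : (8 ^ l = 2 ^ l * 2 ^ l * 2 ^ l)%N by rewrite -!expnMn.
  have z : 2 ^+ l != 0 :> R by rewrite expf_neq0// pnatr_eq0.
  by rewrite !natrM !natrX /d; field.
have Eh : expR (- ((samples s0 l)%:R * h ^+ 2 / 16)) = x ^+ (2 ^ l.+1).
  apply: miss_expE; rewrite /samples natrM (natrX _ 2) (exprS _ l) -E /h.
  by field.
have [q|q] := leP (mu a - mu king) (threshold eps l - h).
- rewrite -Eh; apply: le_trans (_ : wins king a l <= _).
    by rewrite ler_piMr//; lra.
  by apply: win_prob_le => //; lra.
- apply: le_trans (_ : 1 - wins king a l.+1 <= _).
    by rewrite ler_piMl//; lra.
  apply: le_trans (_ : expR (- ((samples s0 l.+1)%:R * h ^+ 2 / 16)) <= _).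
    apply: win_prob_ge => //; move: q; rewrite /threshold dS /h -/d.
    by lra.
  rewrite -Eh ler_expR lerN2 ler_wpM2r// ler_wpM2r ?sqr_ge0//.
  by rewrite ler_nat /samples leq_mul2r leq_exp2l// leqnSn orbT.
Qed.

(** All thresholds exceed eps/4, so passing round [K] alone is a deviation of at least eps/8. *)
Lemma false_accept king a K : mu a < mu king + eps / 8 ->
  wins king a K <= x ^+ (8 ^ K.+1).
Proof.
have /andP[e0 e1] := eps01; move=> ak.
rewrite -(@miss_expE _ ((samples s0 K)%:R * (eps / 8) ^+ 2 / 16)); last first.
  by rewrite /samples expnS !natrM; field.
apply: win_prob_le => //; first by apply/andP; split; lra.
have : 0 < 2 ^- K :> R by rewrite invr_gt0 exprn_gt0.
by rewrite /threshold; nra.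
Qed.

(** Thresholds are at most eps/2, so losing a round is a deviation of at least eps/2. The exponent
    128 * 8^l is weakened to l + 1 to give a geometric series. *)
Lemma false_rejection king a l : mu king + eps <= mu a ->
  1 - wins king a l <= x ^+ l.+1.
Proof.
have /andP[e0 e1] := eps01; move=> ak.
apply: le_trans (_ : x ^+ (128 * 8 ^ l) <= _).
  rewrite -(@miss_expE _ ((samples s0 l)%:R * (eps / 2) ^+ 2 / 16)); last first.
    by rewrite /samples !natrM; field.
  apply: win_prob_ge => //; first by apply/andP; split; lra.
  have : 2 ^- l <= 1 :> R by rewrite invf_le1 ?exprn_gt0// exprn_ege1// ler1n.
  by rewrite /threshold; nra.
by apply: le_miss_exp; have := ltn_expl l (isT : 1 < 8)%N; lia.
Qed.

(** Each term is at most 8 x^2 <= 1/2 times the one before, so the sum is at most twice its first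
    term 64 s0 x^2. *)
Lemma expected_charge (K : nat) :
  \sum_(0 <= l < K) x ^+ (2 ^ l.+1) * (charge s0 l.+1)%:R
  <= 128 * s0%:R * x ^+ 2.
Proof.
apply: le_trans (@sum_halving _ _ _ _ _) _.
- by move=> l; rewrite mulr_ge0 ?exprn_ge0 ?(ltW miss_gt0).
- move=> l; rewrite /charge (expnS 2 l.+1) mul2n -addnn exprD.
  rewrite (expnS 8 l.+2) -mulnA natrM.
  set u := x ^+ _; set v := (8 ^ l.+2 * s0)%:R.
  have u0 : 0 <= u by rewrite exprn_ge0 ?(ltW miss_gt0).
  have v0 : 0 <= v by [].
  have ux : u <= x ^+ 2.
    by apply: le_miss_exp; rewrite expnS leq_pmulr// expn_gt0.
  have u16 : 16 * u <= 1.
    have : x ^+ 2 <= (1 / 4) ^+ 2.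
      by rewrite lerXn2r// ?nnegrE ?(ltW miss_gt0)//; lra.
    move: ux; clearbody u; rewrite [(1 / 4) ^+ 2]expr2 => ux.
    by move: (x ^+ 2) ux => X; lra.
  by have := mulr_ge0 u0 v0; nra.
- by rewrite /charge natrM natrX; lra.
Qed.

Lemma value_le1 (t : program R n.+1) : value mu f t <= 1.
Proof.
elim: t => //= [a|a k IH|p k IH]; first by case/andP: (f01 a).
- have := bern_le (mu01 a) (h := fun=> 1) IH.
  by rewrite /bern; lra.
- have p01 : 0 <= p%:num <= 1 by apply/andP.
  have := bern_le p01 (h := fun=> 1) IH.
  by rewrite /bern; lra.
Qed.

(** A rejection may raise the risk by its charge relative to [W]; on average this is one arm's share
    of the budget risk. *)
Lemma value_challenge_le king a (K : nat) acc rej (V e W : R) :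
  0 < W -> 0 <= e -> value mu f acc <= V + e ->
  (forall l, value mu f (rej l) <= V + (charge s0 l)%:R / W) ->
  value mu f (challenge eps s0 king a 0 K.+1 acc rej)
  <= V + 128 * s0%:R * x ^+ 2 / W + wins king a K * e.
Proof.
move=> W0 e0 accV rejV; rewrite value_challenge.
(* Round 0 gets the trivial bound 1, which meets [charge s0 0] = 0. *)
have := @chal_le R (fun l => wins king a l) _ _ V e
  (fun l => (charge s0 l)%:R / W)
  (fun l => if l is l'.+1 then x ^+ (2 ^ l) else 1) 1 0 K.+1 (wins_itv king a)
  _ e0 _ _ _ (late_rejection king a) accV rejV.
rewrite !mul1r => H; rewrite -addrA -lerBlDl; apply: le_trans (H _ _ _ _) _.
- by apply/andP.
- by move=> l; rewrite divr_ge0// ltW.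
- by case=> // l; rewrite exprn_ge0 ?(ltW miss_gt0).
- by have /andP[] := wins_itv king a 0; lra.
rewrite add0n big_nat_recl//= mul0r mulr0 add0r lerD2r.
under eq_bigr do rewrite mulrA.
by rewrite -mulr_suml ler_wpM2r ?invr_ge0 ?(ltW W0)// expected_charge.
Qed.

(** Every rejection is counted as a failure; summing over the rounds gives x + x^2 + ... <= 2 x. *)
Lemma value_challenge_accept king a (r : nat) acc rej (V : R) :
  mu king + eps <= mu a -> 0 <= V -> value mu f acc <= V ->
  value mu f (challenge eps s0 king a 0 r acc rej) <= V + 2 * x.
Proof.
have x0 := miss_gt0; move=> ka V0 accV; rewrite value_challenge.
have rejV l : value mu f (rej l) <= V + 1.
  by apply: le_trans (value_le1 _) _; rewrite lerDr.
have {}accV : value mu f acc <= V + 0 by rewrite addr0.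
have := @chal_le R (fun l => wins king a l) _ _ V 0 (fun=> 1)
  (fun l => x ^+ l.+1) 1 0 r (wins_itv king a) _ (lexx 0) _ _ _ _ accV rejV.
rewrite !mul1r => H; rewrite -lerBlDl; apply: le_trans (H _ _ _ _ _) _ => //.
- by rewrite ler01 lexx.
- by move=> l; rewrite exprn_ge0// ltW.
- exact: false_rejection.
- move=> l; apply: le_trans (false_rejection l.+1 ka).
  have /andP[w0 w1] := wins_itv king a l.
  by rewrite ler_piMl// subr_ge0; case/andP: (wins_itv king a l.+1).
rewrite {H} mulr0 addr0; under eq_bigr do rewrite mulr1.
apply: le_trans (@sum_halving _ _ _ _ _) _; last by rewrite expr1.
- by move=> l; rewrite exprn_ge0// ltW.
- move=> l; rewrite (exprSr x l.+1) ler_wpM2l ?exprn_ge0 ?(ltW x0)//.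
  by apply: le_trans x_le _; lra.
Qed.

(** * Risk potentials along the scan *)

Context (best : R).
Hypothesis mu_best : forall i, mu i <= best.
Hypothesis f_good : forall i, best - eps <= mu i -> f i = 0.

(* Each correct change of king raises its mean by eps / 8, so that only
   8 (best - mu king) / eps of them can follow; each reign has total
   probability of a false accept at most the sum of x ^+ j over j > 0. *)
Definition reign_risk (king : 'I_n.+1) (j : nat) : R :=
  16 * x * (best - mu king) / eps + 2 * x ^+ j.+1.

(** Markov's inequality as a potential: the charges already spent, plus a bound on the expected
    charges of the [m] arms to come, relative to the initial budget [W]. *)
Definition budget_risk (W : R) (m b : nat) : R :=
  (W - b%:R + m%:R * (128 * s0%:R * x ^+ 2)) / W.

Lemma budget_riskS (W : R) (m b : nat) :
  budget_risk W m.+1 b = budget_risk W m b + 128 * s0%:R * x ^+ 2 / W.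
Proof. by rewrite /budget_risk -mulrDl -natr1; congr (_ / _); ring. Qed.

Lemma budget_riskB (W : R) (m b d : nat) : (d <= b)%N ->
  budget_risk W m (b - d) = budget_risk W m b + d%:R / W.
Proof.
by move=> db; rewrite /budget_risk -mulrDl natrB//; congr (_ / _); ring.
Qed.

Lemma budget_risk_ge0 (W : R) (m b : nat) : b%:R <= W -> 0 <= budget_risk W m b.
Proof.
move=> bW; rewrite divr_ge0 ?(le_trans _ bW)// addr_ge0 ?subr_ge0//.
by rewrite !mulr_ge0// ltW ?miss_gt0.
Qed.

Lemma budget_risk_exhausted (W : R) (m b d : nat) : 0 < W -> (b < d)%N ->
  1 <= budget_risk W m b + d%:R / W.
Proof.
move=> W0 bd; rewrite /budget_risk -mulrDl ler_pdivlMr// mul1r.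
have : b%:R <= d%:R :> R by rewrite ler_nat ltnW.
have : 0 <= m%:R * (128 * s0%:R * x ^+ 2).
  by rewrite !mulr_ge0// ltW ?miss_gt0.
by lra.
Qed.

Lemma reign_risk_ge0 king j : 0 <= reign_risk king j.
Proof.
have /andP[e0 _] := eps01; have x0 := ltW miss_gt0.
by rewrite addr_ge0 ?mulr_ge0 ?exprn_ge0 ?subr_ge0 ?invr_ge0 ?(ltW e0).
Qed.

Lemma reign_riskS king j : reign_risk king j.+1 + x ^+ j.+1 <= reign_risk king j.
Proof.
rewrite /reign_risk (exprS x j.+1).
have : 0 <= x ^+ j.+1 by rewrite exprn_ge0// ltW ?miss_gt0.
by have := x_le; nra.
Qed.

(** The gain of eps/8 lowers the first summand by at least 2 x, the risk of a fresh reign. *)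
Lemma reign_risk_accept king a j : mu king + eps / 8 <= mu a ->
  reign_risk a 0 <= reign_risk king j.
Proof.
have /andP[e0 _] := eps01; have x0 := miss_gt0; move=> ka.
have xj : 0 <= x ^+ j.+1 by rewrite exprn_ge0// ltW.
suff : 16 * x * (best - mu a) / eps + 2 * x
    <= 16 * x * (best - mu king) / eps.
  by rewrite /reign_risk expr1; lra.
rewrite -lerBrDl -mulrBl -mulrBr ler_pdivlMr// -mulrA.
rewrite (_ : 16 * x * _ = 2 * x * (8 * (mu a - mu king))); last by ring.
by rewrite -mulrA !ler_wpM2l// ?(ltW x0)//; lra.
Qed.

(** An arm better by eps/8 is again a good king and its reign is prepaid, so accepting it adds no
    risk; accepting any other arm is written off as a failure, of probability at most x^(j+1). An
    exhausted budget still outputs a good king. *)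
Lemma value_scan_good (W : R) (m c : nat) (king : 'I_n.+1) (j b : nat) :
  0 < W -> b%:R <= W -> best - eps <= mu king ->
  value mu f (scan eps s0 m c king j b)
  <= reign_risk king j + budget_risk W m b.
Proof.
have /andP[e0 e1] := eps01; have x0 := miss_gt0.
move=> W0; elim: m c king j b => [|m IH] c king j b bW kg.
  by rewrite /= value_finish f_good// addr_ge0 ?reign_risk_ge0 ?budget_risk_ge0.
rewrite scanS budget_riskS; set a := inord c.
have rejV l : value mu f (PNext (if (charge s0 l <= b)%N
      then scan eps s0 m c.+1 king j.+1 (b - charge s0 l)
      else finish c.+1 king))
    <= reign_risk king j.+1 + budget_risk W m b + (charge s0 l)%:R / W.
  case: ifP => lb /=.
    rewrite -addrA -budget_riskB//; apply: IH => //.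
    by rewrite (le_trans _ bW)// ler_nat leq_subr.
  rewrite value_finish f_good// addr_ge0//.
    by rewrite addr_ge0 ?reign_risk_ge0 ?budget_risk_ge0.
  by rewrite divr_ge0// ltW.
have xj : 0 <= x ^+ j.+1 by rewrite exprn_ge0// ltW.
have rS := reign_riskS king j.
have [ka|ka] := leP (mu king + eps / 8) (mu a).
- apply: le_trans (@value_challenge_le king a _ _ _
    (reign_risk king j + budget_risk W m b) 0 W W0 _ _ _) _ => //.
  + rewrite addr0 /=; apply: le_trans (IH _ _ _ _ bW _) _; first by lra.
    by rewrite lerD2r reign_risk_accept.
  + by move=> l; apply: le_trans (rejV l) _; lra.
  + by rewrite mulr0 addr0 addrA.
- apply: le_trans (@value_challenge_le king a _ _ _
    (reign_risk king j.+1 + budget_risk W m b) 1 W W0 _ _ rejV) _ => //.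
    apply: le_trans (value_le1 _) _; rewrite lerDr.
    by rewrite addr_ge0 ?reign_risk_ge0 ?budget_risk_ge0.
  have : wins king a (trunc_log 8 j.+1) <= x ^+ j.+1.
    apply: le_trans (false_accept _ ka) _; apply: le_miss_exp.
    by have /andP[_] := trunc_log_bounds (isT : 1 < 8)%N (ltn0Sn j); lia.
  by rewrite mulr1; lra.
Qed.

Lemma reign_risk_best king j : mu king = best -> reign_risk king j <= 2 * x.
Proof.
have x0 := miss_gt0.
move=> kE; rewrite /reign_risk kE subrr mulr0 mul0r add0r ler_wpM2l//.
by rewrite -[leRHS]expr1; exact: le_miss_exp.
Qed.

(** Before [top] arrives the bound holds for any king, so accepts add no risk and only an overrun
    counts as failure. A king that is not good when [top] arrives is worse by more than eps; once a
    king is good, [value_scan_good] applies. *)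
Lemma value_scan (W : R) (m c : nat) (king top : 'I_n.+1) (j b : nat) :
  0 < W -> b%:R <= W -> mu top = best -> (c <= top < c + m)%N ->
  value mu f (scan eps s0 m c king j b) <= 20 * x + budget_risk W m b.
Proof.
have /andP[e0 e1] := eps01; have x0 := miss_gt0.
move=> W0 + mtop; elim: m c king j b => [|m IH] c king j b bW ctop.
  by move: ctop; rewrite addn0; lia.
have [ktop|ktop] := leP (best - eps) (mu king).
  have H := @value_scan_good W m.+1 c king j b W0 bW ktop.
  apply: (le_trans H); rewrite lerD2r /reign_risk.
  have : 16 * x * (best - mu king) / eps <= 16 * x.
    by rewrite ler_pdivrMr// ler_wpM2l ?mulr_ge0 ?(ltW x0)//; lra.
  have : x ^+ j.+1 <= x by rewrite -[leRHS]expr1; exact: le_miss_exp.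
  set u := _ / eps; set v := x ^+ _; clearbody u v.
  by move=> vx ux; lra.
rewrite scanS budget_riskS; set a := inord c.
have [ctop'|ctop'] := ltnP c top.
  apply: le_trans (@value_challenge_le king a _ _ _
    (20 * x + budget_risk W m b) 0 W W0 _ _ _) _ => //.
  - by rewrite addr0 /=; apply: IH => //; lia.
  - move=> l; case: ifP => lb /=.
      rewrite -addrA -budget_riskB//; apply: IH; last by lia.
      by rewrite (le_trans _ bW)// ler_nat leq_subr.
    apply: le_trans (value_le1 _) _.
    rewrite -addrA ler_wpDl ?mulr_ge0 ?(ltW x0)//.
    by apply: budget_risk_exhausted => //; lia.
  - by rewrite mulr0 addr0 addrA.
have atop : a = top.
  have tn := ltn_ord top.
  by apply: val_inj; rewrite /a /= inordK; lia.
apply: le_trans (@value_challenge_accept king a _ _ _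
  (2 * x + budget_risk W m b) _ _ _) _.
- by rewrite atop mtop; lra.
- by rewrite addr_ge0 ?budget_risk_ge0// mulr_ge0// ltW.
- apply: le_trans (@value_scan_good W m c.+1 a 0 b W0 bW _) _.
    by rewrite atop mtop; lra.
  by rewrite lerD2r reign_risk_best// atop.
- have : 0 <= 128 * s0%:R * x ^+ 2 / W.
    by rewrite divr_ge0 ?(ltW W0)// !mulr_ge0// ltW.
  by lra.
Qed.

Lemma value_scan_from (W : R) (lo m b : nat) (top : 'I_n.+1) :
  0 < W -> b%:R <= W -> mu top = best -> (lo <= top <= lo + m)%N ->
  (lo <= n)%N ->
  value mu f (scan_from eps s0 lo m b) <= 20 * x + budget_risk W m b.
Proof.
have x0 := miss_gt0.
move=> W0 bW mtop /andP[lotop toplo] lon.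
rewrite /scan_from value_iter_next /=.
have [loE|lotop'] := eqVneq (inord lo) top.
  apply: le_trans (@value_scan_good W m lo.+1 (inord lo) 0 b W0 bW _) _.
    by rewrite loE mtop; case/andP: eps01; lra.
  rewrite lerD2r loE (le_trans (reign_risk_best _ mtop))//; lra.
apply: value_scan W0 bW mtop _.
rewrite ltn_neqAle lotop andbT addSn ltnS toplo andbT.
by apply/eqP => E; move: lotop'; rewrite E inord_val eqxx.
Qed.

End analysis.

(** * Choice of the parameters *)

(** Tosses of bias 1/(M + 1), 1/M, ..., 1/2 give the indices 0 to [M] equal probability. *)
Fixpoint pick_uniform (R : realType) (n M : nat) (t : nat -> program R n)
    : program R n :=
  if M is M'.+1 then
    PToss (clamp_i01 (M'.+2%:R^-1))
      (fun b => if b then t M'.+1 else pick_uniform M' t)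
  else t 0%N.

Lemma streaming_pick_uniform (R : realType) (n m c : nat) (A : {set 'I_n})
    (M : nat) (t : nat -> program R n) :
  (forall i, streaming m c A (compile (t i))) ->
  streaming m c A (compile (pick_uniform M t)).
Proof. by move=> H; elim: M => //= M IH []. Qed.

Lemma pulls_pick_uniform (R : realType) (n B M : nat)
    (t : nat -> program R n) :
  (forall i, pulls_at_most B (compile (t i))) ->
  pulls_at_most B (compile (pick_uniform M t)).
Proof. by move=> H; elim: M => //= M IH []. Qed.

Lemma value_pick_uniform (R : realType) (n : nat) (mu f : 'I_n.+1 -> R)
    (M i : nat) (t : nat -> program R n.+1) :
  (forall a, 0 <= mu a <= 1) -> (forall a, 0 <= f a <= 1) -> (i <= M)%N ->
  value mu f (pick_uniform M t) <= 1 - (1 - value mu f (t i)) / M.+1%:R.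
Proof.
move=> mu01 f01; elim: M i => [|M IH] i.
  by rewrite leqn0 => /eqP ->; rewrite divr1; lra.
move=> iM; rewrite [pick_uniform _ _]/= [value _ _ (PToss _ _)]/=.
have M0 : 0 < M.+1%:R :> R by [].
rewrite clamp01_id; last first.
  by rewrite invr_ge0 ler0n invf_le1 ?ler1n.
set p := M.+2%:R^-1.
have p01 : 0 <= p <= 1 by rewrite invr_ge0 ler0n invf_le1 ?ler1n.
have pM : (1 - p) / M.+1%:R = p.
  rewrite /p -[M.+2%:R]natr1; field.
  by rewrite gt_eqF//= natr1 pnatr_eq0.
have /andP[p0 p1] := p01.
have [->|iM'] := eqVneq i M.+1.
  have := value_le1 mu01 f01 (pick_uniform M t).
  by rewrite -/p; set v := value _ _ _; set u := value _ _ _; nra.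
have := IH i; rewrite -ltnS ltn_neqAle iM' iM => /(_ isT) {}IH.
set q := value mu f (t i) in IH *.
have E : (1 - p) * (1 - (1 - q) / M.+1%:R) = (1 - p) - (1 - q) * p.
  by rewrite mulrBr mulr1 mulrCA pM.
have := value_le1 mu01 f01 (t M.+1).
have : (1 - p) * value mu f (pick_uniform M t) <= (1 - p) - (1 - q) * p.
  by rewrite -E ler_wpM2l// subr_ge0.
by set u := value mu f (t M.+1); nra.
Qed.

Lemma value_compl (R : realType) (n : nat) (mu f : 'I_n -> R)
    (t : program R n) :
  value mu (fun a => 1 - f a) t = 1 - value mu f t.
Proof. by elim: t => //= [a k IH|p k IH]; rewrite !IH; ring. Qed.

Lemma ln_inv_ge (R : realType) (d : R) : 0 < d -> 1 - d <= ln (1 / d).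
Proof.
move=> d0; rewrite div1r lnV ?posrE//.
have := @le_ln1Dx R (d - 1); rewrite subrKC => H.
by have := H _; lra.
Qed.

(** A block fails with probability at most 20 x + x^2 <= 21 x, hence the target d / 21. *)
Lemma sample_size (R : realType) :
  exists2 C : R, 0 < C &
  forall eps d : R, 0 < eps < 1 -> 0 < d <= 1 / 2 ->
  exists2 s0 : nat,
    s0%:R <= C * (ln (1 / d) / eps ^+ 2) & miss eps s0 <= d / 21.
Proof.
rewrite /miss; have : 0 < 8192 :> R by rewrite ltr0n.
move: (8192 : R) => c c0.
(* The 6 comes from 21 / d <= (1 / d)^6, the 2 from rounding up, as 1 <= 2 ln (1 / d) / eps^2. *)
exists (c * 6 + 2); first by rewrite addr_gt0// mulr_gt0.
move=> eps d /andP[e0 e1] /andP[d0 d2].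
have e20 : 0 < eps ^+ 2 by rewrite exprn_gt0.
have e21 : eps ^+ 2 <= 1 by rewrite expr_le1 ?ltW.
have L2 := ln_inv_ge d0.
have i0 : 2 <= 1 / d by rewrite ler_pdivlMr//; lra.
have L6 : ln (21 / d) <= 6 * ln (1 / d).
  have -> : 6 * ln (1 / d) = ln ((1 / d) ^+ 6).
    by rewrite lnXn ?mulr_natl//; lra.
  rewrite ler_ln ?posrE ?exprn_gt0 ?divr_gt0//.
  rewrite exprS (_ : 21 / d = 1 / d * 21); last by field; rewrite gt_eqF.
  rewrite ler_wpM2l//; first by lra.
  apply: le_trans (_ : 2 ^+ 5 <= _); last by rewrite lerXn2r ?nnegrE//; lra.
  by rewrite -natrX ler_nat.
pose T : R := c * ln (21 / d) / eps ^+ 2.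
have T0 : 0 <= T.
  rewrite divr_ge0 ?(ltW e20)// mulr_ge0 ?(ltW c0)// ln_ge0// ler_pdivlMr//.
  by lra.
have /andP[T1 T2] := truncn_itv T0.
exists (Num.truncn T).+1.
  rewrite -natr1; apply: le_trans (_ : T + 1 <= _); first by lra.
  have : T <= c * (6 * (ln (1 / d) / eps ^+ 2)).
    by rewrite /T -!mulrA ler_wpM2l ?(ltW c0)// mulrA ler_wpM2r// invr_ge0 ltW.
  have : 1 <= 2 * (ln (1 / d) / eps ^+ 2).
    by rewrite mulrA ler_pdivlMr// [leLHS]mul1r; lra.
  by move=> H2 H1; rewrite [leRHS]mulrDl -[c * 6 * _]mulrA lerD.
have d21 : 0 < d / 21 by rewrite divr_gt0.
rewrite -[leRHS]lnK ?posrE// ler_expR.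
have -> : ln (d / 21) = - ln (21 / d) by rewrite -lnV ?posrE ?divr_gt0// invf_div.
rewrite lerN2 ler_pdivlMr// mulrC [leRHS]mulrC -ler_pdivrMr//.
exact: ltW.
Qed.

(** As delta tends to 1, ln (1 / delta) vanishes and not even one pull per arm is affordable, hence
    the single block at confidence 1/2. The quotient counts challengers, so a block of one arm costs
    nothing. *)
Lemma block_count (R : realType) (n : nat) (delta : R) : 0 < delta < 1 ->
  exists (d : R) (M : nat),
    [/\ 0 < d <= 1 / 2, 1 - delta <= (1 - d) / M.+1%:R &
        ln (1 / d) * (n %/ M.+1)%:R <= 4 * (n.+1%:R * ln (1 / delta))].
Proof.
move=> /andP[d0 d1]; have L := ln_inv_ge d0.
have n0 : 0 <= n%:R :> R by [].
have nS : n.+1%:R = n%:R + 1 :> R by rewrite natr1.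
have [d2|d2] := leP delta (1 / 2).
  exists delta, 0%N; split; rewrite ?d0//= ?divr1// divn1 nS.
  have : 0 <= n%:R * ln (1 / delta) by rewrite mulr_ge0//; lra.
  by lra.
pose p := 1 - delta; have p0 : 0 < p by rewrite subr_gt0.
(* M + 1 is the floor of [T]: M + 1 <= T makes the success 1 / (2 (M + 1)) at least p, and T < M + 2
   gives 1 <= 4 p (M + 1). *)
pose T := 1 / (2 * p); have T1 : 1 <= T.
  by rewrite ler_pdivlMr ?mulr_gt0// mul1r /p; lra.
have /andP[M1 M2] := truncn_itv (le_trans ler01 T1).
have : (0 < Num.truncn T)%N by rewrite truncn_gt0.
case: (Num.truncn T) M1 M2 => // M M1 M2 _.
exists (1 / 2), M; split; first by apply/andP; split; lra.
  rewrite ler_pdivlMr// -/p.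
  by have := M1; rewrite ler_pdivlMr ?mulr_gt0//; lra.
have ln2 : ln (1 / (1 / 2)) <= 1 :> R.
  rewrite (_ : 1 / (1 / 2) = 1 + 1 :> R); last by field.
  by apply: le_ln1Dx; lra.
have M4 : 1 <= 4 * p * M.+1%:R.
  move: M2; rewrite -natr1 ltr_pdivrMr ?mulr_gt0//.
  have : 1 <= M.+1%:R :> R by rewrite ler1n.
  by nra.
have mM : (n %/ M.+1)%:R * M.+1%:R <= n%:R :> R.
  by rewrite -natrM ler_nat leq_trunc_div.
set m := (n %/ M.+1)%:R in mM *; have m0 : 0 <= m by [].
apply: le_trans (_ : m <= _); first by rewrite ler_piMl.
apply: le_trans (_ : m * (4 * p * M.+1%:R) <= _); first by rewrite ler_peMr.
rewrite (_ : m * _ = 4 * ((m * M.+1%:R) * p)); last by ring.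
rewrite ler_wpM2l// ler_pM ?mulr_ge0 ?(ltW p0)//.
by rewrite nS (le_trans mM)// lerDl.
Qed.

(** Blocks start at multiples of m + 1; one that would overrun the stream is shifted back to end at
    the last arm. *)
Lemma mem_block (n m k : nat) : (m <= n)%N -> (k <= n)%N ->
  let lo := minn (k %/ m.+1 * m.+1) (n - m) in (lo <= k <= lo + m)%N.
Proof.
move=> mn kn; have := divn_eq k m.+1; have := ltn_pmod k (ltn0Sn m).
by move: (k %/ m.+1 * m.+1)%N (k %% m.+1)%N => /= q r; lia.
Qed.

Lemma value_block (R : realType) (n : nat) (eps d best : R) (s0 lo m : nat)
    (mu f : 'I_n.+1 -> R) (top : 'I_n.+1) :
  0 < eps < 1 -> 0 < d <= 1 / 2 -> miss eps s0 <= d / 21 -> (0 < s0)%N ->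
  (forall i, 0 <= mu i <= 1) -> (forall i, 0 <= f i <= 1) ->
  (forall i, mu i <= best) -> (forall i, best - eps <= mu i -> f i = 0) ->
  mu top = best -> (lo <= top <= lo + m)%N ->
  value mu f (scan_from eps s0 lo m (128 * s0 * m)) <= d.
Proof.
move=> eps01 /andP[d0 d2] xd s00 mu01 f01 mub fg mtop lotop.
(* With a single arm [W] would be 0; that arm is [top] itself. *)
case: m lotop => [|m] lotop.
  rewrite /scan_from value_iter_next /= value_finish.
  have -> : inord lo = top.
    have tn := ltn_ord top; apply: val_inj; rewrite /= inordK; lia.
  by rewrite fg ?ltW// mtop; case/andP: eps01; lra.
set W : R := (128 * s0 * m.+1)%:R.
have W0 : 0 < W by rewrite ltr0n !muln_gt0 s00.
have x0 := miss_gt0 eps s0.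
have x4 : miss eps s0 <= 1 / 4 by lra.
have tn := ltn_ord top.
have lon : (lo <= n)%N by lia.
apply: le_trans (value_scan_from eps01 mu01 f01 x4 mub fg W0 (lexx W) mtop
  lotop lon) _.
(* The full budget is x^-2 times the bound on the expected charges. *)
have -> : budget_risk eps s0 W m.+1 (128 * s0 * m.+1) = miss eps s0 ^+ 2.
  rewrite /budget_risk -/W subrr add0r.
  rewrite (_ : m.+1%:R * _ = miss eps s0 ^+ 2 * W); last first.
    by rewrite /W !natrM; ring.
  by rewrite mulfK// gt_eqF.
have : miss eps s0 ^+ 2 <= miss eps s0 by rewrite expr2 ler_piMr ?ltW//; lra.
lra.
Qed.

Theorem theorem5 (R : realType) :
  exists2 C : R, 0 < C &
  forall (n : nat) (eps delta : R),
    (0 < n)%N -> 0 < eps < 1 -> 0 < delta < 1 ->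
  exists (t : algorithm R n) (B : nat),
    [/\ streaming 2 0 finset.set0 t,
        pulls_at_most B t,
        B%:R <= C * (n%:R / eps ^+ 2 * ln (1 / delta)
                     + ln n%:R ^+ 2 * (ln (1 / delta) ^+ 2 / eps ^+ 3)) &
        forall nu : 'I_n -> probability (measurableTypeR R) R,
          (forall i, nu i `[0, 1]%classic = 1%E) ->
          measurable_behaviour nu t /\
          ((1 - delta)%:E <= output_prob nu (best_arms nu eps) t)%E].
Proof.
have [C0 C00 sampleP] := sample_size R.
(* Here 144 = 128 + 16 adds the late budget and the amortised pulls per challenger; 4 comes from
   [block_count]. *)
exists (144 * 4 * C0); first by rewrite !mulr_gt0.
case=> // n eps delta _ eps01 delta01; have /andP[e0 e1] := eps01.
have [d [M [d01 dM dL]]] := block_count n delta01.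
have [s0 s0L xd] := sampleP eps d eps01 d01.
set m := (n %/ M.+1)%N in dL *.
have mn : (m <= n)%N by exact: leq_div.
have s00 : (0 < s0)%N.
  rewrite lt0n; apply/eqP => s0E; move: xd; rewrite s0E /miss.
  by rewrite mulr0 mul0r oppr0 expR0; case/andP: d01; lra.
pose lo i := minn (i * m.+1) (n - m).
pose t : program R n.+1 :=
  pick_uniform M (fun i => scan_from eps s0 (lo i) m (128 * s0 * m)).
exists (compile t), (144 * s0 * m)%N; split.
- apply: streaming_pick_uniform => i; apply: streaming_scan_from.
  by rewrite -[leqRHS](subnK mn) leq_add2r geq_minr.
- apply: pulls_pick_uniform => i.
  by apply: pulls_at_mostW (pulls_scan_from _ _ _ _ _); rewrite -!mulnA -mulnDl.
- apply: le_trans (_ : 144 * 4 * C0 * (n.+1%:R / eps ^+ 2 * ln (1 / delta)) <= _).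
    rewrite natrM (natrM _ 144) -!mulrA ler_wpM2l//.
    apply: le_trans (_ : C0 * (ln (1 / d) / eps ^+ 2) * m%:R <= _).
      by rewrite ler_wpM2r.
    rewrite [leRHS]mulrCA -mulrA ler_wpM2l ?(ltW C00)//.
    rewrite mulrAC [leRHS](_ : _
      = 4 * (n.+1%:R * ln (1 / delta)) / eps ^+ 2); last by ring.
    by rewrite ler_wpM2r// invr_ge0 exprn_ge0// ltW.
  rewrite ler_wpM2l ?mulr_ge0 ?(ltW C00)// lerDl mulr_ge0 ?sqr_ge0//.
  by rewrite divr_ge0 ?sqr_ge0// exprn_ge0// ltW.
- move=> nu nu01; split; first exact: measurable_compile.
  rewrite output_prob_compile// lee_fin.
  set mu := fun i => mean (nu i).
  have mu01 i : 0 <= mu i <= 1 by exact: mean_itv.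
  pose f i : R := (i \notin best_arms nu eps)%:R.
  have f01 i : 0 <= f i <= 1.
    by rewrite /f; case: (_ \notin _); rewrite /= ?lexx ?ler01.
  pose top := [arg max_(i > (ord0 : 'I_n.+1)) mu i]%O.
  have topP i : mu i <= mu top.
    by rewrite /top; case: arg_maxP => // j _; apply.
  have fg i : mu top - eps <= mu i -> f i = 0.
    move=> ti; rewrite /f (_ : i \in _)// inE (le_trans _ ti)// lerB//.
    by apply: bigmax_le => [|j _]; exact: topP.
  have -> : value mu (fun a => (a \in best_arms nu eps)%:R) t = 1 - value mu f t.
    rewrite -value_compl; congr (value mu _ t); apply/funext => a.
    by rewrite /f; case: (_ \in _); rewrite /= ?subr0 ?subrr.
  pose i := (top %/ m.+1)%N.
  have tn := ltn_ord top.
  (* The M + 1 blocks of m + 1 arms cover the stream, as n < (M + 1)(m + 1). *)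
  have iM : (i <= M)%N.
    rewrite -ltnS ltn_divLR// mulnC; apply: leq_trans tn _.
    exact: ltn_ceil.
  have := value_pick_uniform (fun i =>
    scan_from eps s0 (lo i) m (128 * s0 * m)) mu01 f01 iM.
  have ltop : (lo i <= top <= lo i + m)%N.
    exact: mem_block.
  have := value_block eps01 d01 xd s00 mu01 f01 topP fg erefl ltop.
  move=> vd vt; apply: le_trans dM _; rewrite lerBrDr -lerBrDl.
  apply: le_trans vt _; rewrite lerD2l lerN2 ler_wpM2r// lerD2l lerN2//.
Qed.
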